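(* Let $q$ be a power of $2$ and $n\ge 2$. Then, up to monomial equivalence, the symplectic line-Grassmann code $\mathcal{P}^{\mathrm{sp}}_{n,2}$ is a proper subcode of the orthogonal line-Grassmann code $\mathcal{P}_{n,2}$, of codimension $2n$. Here the coordinate positions of the two codes are identified through the bijection $\ell\mapsto \langle \ell,N\rangle/N$ from the totally singular lines of $V$ to the totally isotropic lines of $V/N$.
   Context: Let $V=V(2n+1,q)$ with $q$ even, with non-degenerate quadratic form $\eta(x)=\sum_{i=1}^n x_{2i-1}x_{2i}+x_{2n+1}^2$, and let $\beta(x,y)=\eta(x+y)-\eta(x)-\eta(y)$. The radical of $\beta$ is the $1$-dimensional subspace $N=\langle e_{2n+1}\rangle$ (the nucleus), and $\beta$ induces a non-degenerate alternating form $\beta^{\mathrm{sp}}$ on the $2n$-dimensional space $V/N$. ''Line'' means $2$-dimensional vector subspace. Given a set $\mathcal{T}$ of lines of a vector space $U$ over $\mathbb{F}_q$, fix for each $\ell=\langle v_1,v_2\rangle\in\mathcal{T}$ the vector representative $v_1\wedge v_2\in\bigwedge^2U$; the associated projective code is the set of all words $(\varphi(v_1,v_2))_{\ell\in\mathcal{T}}$ as $\varphi$ ranges over the alternating bilinear forms on $U$; it is well defined up to monomial equivalence. The orthogonal line-Grassmann code $\mathcal{P}_{n,2}$ is the code obtained from $U=V$ and $\mathcal{T}=\Delta_2$, the set of lines of $V$ totally singular for $\eta$. The symplectic line-Grassmann code $\mathcal{P}^{\mathrm{sp}}_{n,2}$ is the code obtained from $U=V/N$ and $\mathcal{T}=\Delta_2^{\mathrm{sp}}$,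 the set of lines of $V/N$ totally isotropic for $\beta^{\mathrm{sp}}$. The map $\ell\mapsto\langle\ell,N\rangle/N$ is a bijection $\Delta_2\to\Delta_2^{\mathrm{sp}}$. *)

(* Defs.v *)
From HB Require Import structures.
From mathcomp Require Import all_boot all_algebra all_field.

Set Implicit Arguments.
Unset Strict Implicit.
Unset Printing Implicit Defensive.

Import GRing.Theory.
Local Open Scope ring_scope.

Import VectorInternalTheory.

HB.instance Definition _ (F : finFieldType) (U : vectType F) :=
  [Countable of space U by <:].
HB.instance Definition _ (F : finFieldType) (U : vectType F) :=
  [Finite of space U by <:].

Section LineCodes.

Variables (F : finFieldType) (U : vectType F).

(* Bilinear forms on U, in curried form. *)
Definition bilin_form := 'Hom(U, 'Hom(U, F^o)).

Definition diag_eval (x : U) (phi : bilin_form) : F^o := phi x x.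

Fact diag_eval_linear x : linear (diag_eval x).
Proof. by move=> a phi psi; rewrite /diag_eval !lfunE /= !lfunE. Qed.

HB.instance Definition _ x :=
  GRing.isLinear.Build F bilin_form F^o *:%R (diag_eval x)
    (diag_eval_linear x).

(* finvect_type U is U itself, equipped with its finType structure. *)
Definition alt_forms : {vspace bilin_form} :=
  (\bigcap_(x : finvect_type U) lker (linfun (diag_eval x)))%VS.

Lemma alt_formsP (phi : bilin_form) :
  reflect (forall x : U, phi x x = 0) (phi \in alt_forms).
Proof.
apply: (iffP idP) => [h x | h].
  have := subvP (bigcapv_inf (x : finvect_type U) isT (subvv _)) phi h.
  by rewrite memv_ker lfunE /= => /eqP.
rewrite memvE; apply/subv_bigcapP => x _; rewrite -memvE memv_ker lfunE /=.
by apply/eqP; exact: h.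
Qed.

Variables (I : finType) (b : I -> U * U).

Definition codeword (phi : bilin_form) : {ffun I -> F^o} :=
  [ffun i => phi (b i).1 (b i).2].

Fact codeword_linear : linear codeword.
Proof.
by move=> a phi psi; apply/ffunP => i; rewrite !ffunE !lfunE /= !lfunE.
Qed.

HB.instance Definition _ :=
  GRing.isLinear.Build F bilin_form {ffun I -> F^o} *:%R codeword
    codeword_linear.

(* The code attached to the system of vectors (b i).1 /\ (b i).2, i in I. *)
Definition line_code : {vspace {ffun I -> F^o}} :=
  (linfun codeword @: alt_forms)%VS.

Lemma line_codeP (w : {ffun I -> F^o}) :
  reflect (exists2 phi : bilin_form, forall x : U, phi x x = 0 &
             w = [ffun i => phi (b i).1 (b i).2])
          (w \in line_code).
Proof.
apply: (iffP memv_imgP) => [[phi /alt_formsP h ->] | [phi h ->]].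
  by exists phi => //; rewrite lfunE.
by exists phi; [exact/alt_formsP | rewrite lfunE].
Qed.

End LineCodes.

(* b chooses an (ordered) basis of each of the lines ell i. *)
Definition line_bases (F : fieldType) (U : vectType F) (I : Type)
    (ell : I -> {vspace U}) (b : I -> U * U) : Prop :=
  forall i, basis_of (ell i) [:: (b i).1; (b i).2].

(* D is the image of C under a monomial transformation whose matching of the
   coordinate positions is the bijection f. *)
Definition monomially_equivalent_along (F : fieldType) (I J : finType)
    (f : J -> I) (C : {vspace {ffun I -> F^o}})
    (D : {vspace {ffun J -> F^o}}) : Prop :=
  bijective f /\
  exists2 d : J -> F, forall j, d j != 0 &
    forall w, w \in D <->
      exists2 c : {ffun I -> F^o}, c \in C & w = [ffun j => d j * c (f j)].

Definition quotient_map (F : fieldType) (V W : vectType F) (N : {vspace V})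
    (pi : 'Hom(V, W)) : Prop :=
  limg pi = fullv /\ lker pi = N.

Section OrthogonalSpace.

Variables (F : finFieldType) (n : nat).

Local Notation V := 'rV[F]_(2 * n).+1.

(* Coordinates are numbered from 0, so the last one has index 2n. *)
Definition eta (x : V) : F :=
  \sum_(i < n) x 0 (inord (2 * i)) * x 0 (inord (2 * i).+1)
  + x 0 ord_max ^+ 2.

Definition beta (x y : V) : F := eta (x + y) - eta x - eta y.

Definition nucleus : {vspace V} := <[(delta_mx 0 ord_max)%R]>%VS.

Definition is_sing_line (l : {vspace V}) : bool :=
  (\dim l == 2) && [forall x : V, (x \in l) ==> (eta x == 0)].

Definition sing_line := {l : {vspace V} | is_sing_line l}.

Variables (W : vectType F) (pi : 'Hom(V, W)).

(* The form induced by beta on W = V / N; pi^-1 picks representatives, and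
   beta_sp_pi below shows that the choice is irrelevant. *)
Definition beta_sp (u v : W) : F := beta ((pi^-1)%VF u) ((pi^-1)%VF v).

Definition is_isot_line (l : {vspace W}) : bool :=
  (\dim l == 2) &&
  [forall u : finvect_type W, forall v : finvect_type W,
     ((u : W) \in l) ==> ((v : W) \in l) ==> (beta_sp u v == 0)].

Definition isot_line := {l : {vspace W} | is_isot_line l}.

Variable h : nat.
Hypothesis card_F : #|F| = (2 ^ h)%N.
Hypothesis pi_quotient : quotient_map nucleus pi.

Lemma eta_addN (x : V) a :
  eta (x + a *: delta_mx 0 ord_max) = eta x + a ^+ 2.
Proof.
have ch2 : 2%N \in [pchar F] by exact: card_finPcharP card_F isT.
have E (i : 'I_(2 * n).+1) : (i < 2 * n)%N ->
    (x + a *: delta_mx 0 ord_max) 0 i = x 0 i.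
  move=> lti; rewrite !mxE eqxx /= -val_eqE /= (ltn_eqF lti) mulr0.
  by rewrite addr0.
rewrite /eta [X in _ + X]/= -addrA; congr (_ + _).
  apply: eq_bigr => i _.
  have lti := ltn_ord i.
  have lt1 : ((2 * i).+1 < 2 * n)%N by rewrite !mul2n -doubleS leq_double.
  by rewrite !E // inordK ?(ltnW lt1) // ltnS ltnW // ltnW.
rewrite !mxE !eqxx /= mulr1.
by have := pFrobenius_autD_comm ch2 (mulrC (x 0 ord_max) a);
  rewrite !pFrobenius_autE.
Qed.

Lemma beta_addN (x y : V) a c :
  beta (x + a *: delta_mx 0 ord_max) (y + c *: delta_mx 0 ord_max) = beta x y.
Proof.
have ch2 : 2%N \in [pchar F] by exact: card_finPcharP card_F isT.
rewrite /beta addrACA -scalerDl !eta_addN.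
have -> : (a + c) ^+ 2 = a ^+ 2 + c ^+ 2.
  by have := pFrobenius_autD_comm ch2 (mulrC a c); rewrite !pFrobenius_autE.
rewrite -[LHS]addrA -opprD [eta x + _ + _]addrACA opprD.
by rewrite [LHS]addrACA subrr addr0 opprD addrA.
Qed.

Lemma piK (x : V) :
  exists a : F, ((pi^-1)%VF (pi x)) = x + a *: delta_mx 0 ord_max.
Proof.
case: pi_quotient => _ kerpi.
have /vlineP[a Ea] : (pi^-1)%VF (pi x) - x \in nucleus.
  by rewrite -kerpi memv_ker linearB /= limg_lfunVK ?memv_img ?memvf // subrr.
by exists a; rewrite -Ea addrC subrK.
Qed.

Lemma beta_sp_pi (x y : V) : beta_sp (pi x) (pi y) = beta x y.
Proof.
by rewrite /beta_sp; case: (piK x) => a ->; case: (piK y) => c ->;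
  rewrite beta_addN.
Qed.

Lemma pi_sing_line (l : sing_line) : is_isot_line (pi @: val l)%VS.
Proof.
case: l => l /= /andP[/eqP diml /forallP sl].
have {}sl x : x \in l -> eta x = 0 by move=> xl; exact/eqP/(implyP (sl x)).
apply/andP; split.
  rewrite limg_dim_eq ?diml //; apply/eqP; rewrite -subv0.
  apply/subvP => x; rewrite memv_cap (proj2 pi_quotient) memv0.
  case/andP => xl /vlineP[a Ea].
  have eta0 : eta 0 = 0.
    by rewrite /eta big1 => [|i _]; rewrite !mxE ?mul0r ?expr0n ?addr0.
  have /eqP := sl x xl; rewrite {1}Ea -[X in eta X]add0r eta_addN eta0 add0r.
  by rewrite sqrf_eq0 => /eqP a0; rewrite Ea a0 scale0r.
apply/forallP => u; apply/forallP => v.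
apply/implyP => /memv_imgP[x xl ->]; apply/implyP => /memv_imgP[y yl ->].
by rewrite beta_sp_pi /beta !sl ?memvD // !subr0.
Qed.

(* l |-> <l, N> / N *)
Definition line_proj (l : sing_line) : isot_line := Sub _ (pi_sing_line l).

End OrthogonalSpace.

(* Main.v *)
(* The symplectic code consists, up to scalars on the coordinates, of the words
   of those alternating forms on V that have N in their radical; these forms have
   codimension 2n among all alternating forms, since contraction with e_{2n+1}
   maps the latter onto the annihilator of N in the dual of V.  Passing from forms
   to words preserves this codimension, because a form phi vanishing on every
   totally singular line has N in its radical: if x is a singular basis vector
   and (p, q) a hyperbolic pair orthogonal to x (this needs n >= 2), then p, q and
   p + q + e_{2n+1} are singular and orthogonal to x, so
   phi(x, e_{2n+1}) = phi(x, p + q + e_{2n+1}) - phi(x, p) - phi(x, q) = 0. *)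

From HB Require Import structures.
From mathcomp Require Import all_boot all_algebra all_field.
From mathcomp Require Import ring zify.
Require Import Defs.

Set Implicit Arguments.
Unset Strict Implicit.
Unset Printing Implicit Defensive.

Import GRing.Theory.
Local Open Scope ring_scope.

(** * Spans and independence of two vectors *)

Lemma mem_span2P (K : fieldType) (U : vectType K) (u v x : U) :
  reflect (exists a c, x = a *: u + c *: v) (x \in <<[:: u; v]>>%VS).
Proof.
rewrite span_cons span_seq1; apply: (iffP memv_addP) => [|[a [c ->]]].
  by case=> _ /vlineP[a ->] [_ /vlineP[c ->] ->]; exists a, c.
by exists (a *: u); [|exists (c *: v)]; rewrite ?memvZ ?memv_line.
Qed.

Lemma free2P (K : fieldType) (U : vectType K) (u v : U) :
  reflect (forall a c, a *: u + c *: v = 0 -> a = 0 /\ c = 0)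
    (free [:: u; v]).
Proof.
apply: (iffP (@freeP _ _ _ [tuple u; v])) => [h a c E | h k].
  have := h (fun i : 'I_2 => if i == 0 :> nat then a else c).
  rewrite !big_ord_recl big_ord0 /= addr0 => /(_ E) Z.
  by split; [exact: (Z ord0) | exact: (Z (lift ord0 ord0))].
rewrite !big_ord_recl big_ord0 /= addr0 => /h[k0 k1] [[|[|//]] ltj].
  by rewrite -k0; congr k; apply: val_inj.
by rewrite -k1; congr k; apply: val_inj.
Qed.

(** * Bilinear and alternating forms *)

Section Forms.

Variables (F : finFieldType) (U : vectType F).
Implicit Type phi : bilin_form U.

Lemma bilin_form_exists (B : U -> U -> F^o) :
    (forall x, linear (B x)) -> (forall y, linear (B^~ y)) ->
  exists phi, forall x y, phi x y = B x y.
Proof.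
move=> Br Bl.
pose R x : {linear U -> F^o} :=
  HB.pack (B x) (GRing.isLinear.Build F U F^o *:%R (B x) (Br x)).
have lin_R : linear (fun x => linfun (R x)).
  by move=> a x y; apply/lfunP => z; rewrite add_lfunE scale_lfunE !lfunE; exact: Bl.
pose L : {linear U -> 'Hom(U, F^o)} :=
  HB.pack (fun x => linfun (R x)) (GRing.isLinear.Build _ _ _ _ _ lin_R).
by exists (linfun L) => x y; rewrite !lfunE.
Qed.

Lemma bilinDl phi x y z : phi (x + y) z = phi x z + phi y z.
Proof. by rewrite linearD lfunE. Qed.

Lemma bilinZl phi a x z : phi (a *: x) z = a * phi x z.
Proof. by rewrite linearZ lfunE. Qed.

Lemma bilinZr phi a x z : phi x (a *: z) = a * phi x z.
Proof. by rewrite linearZ. Qed.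

Lemma alt_form_anti phi (alt : forall x, phi x x = 0) x y :
  phi x y = - phi y x.
Proof.
apply/eqP; rewrite -addr_eq0; have := alt (x + y).
by rewrite bilinDl !linearD /= !alt add0r addr0 => ->.
Qed.

Lemma alt_form_comb phi (alt : forall x, phi x x = 0) u v a c a' c' :
  phi (a *: u + c *: v) (a' *: u + c' *: v) = (a * c' - c * a') * phi u v.
Proof.
rewrite bilinDl !linearD /= !bilinZl !bilinZr !alt (alt_form_anti alt v u).
ring.
Qed.

(* v1 /\ v2 depends on the basis of a line only up to a nonzero scalar. *)
Lemma alt_form_basis_change (l : {vspace U}) u v x y :
    basis_of l [:: u; v] -> basis_of l [:: x; y] ->
  exists2 d : F, d != 0 &
    forall phi, (forall z, phi z z = 0) -> phi x y = d * phi u v.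
Proof.
move=> /andP[/eqP spuv _] bxy.
have /mem_span2P[a [c Ex]] : x \in <<[:: u; v]>>%VS.
  by rewrite spuv (basis_mem bxy) // inE eqxx.
have /mem_span2P[a' [c' Ey]] : y \in <<[:: u; v]>>%VS.
  by rewrite spuv (basis_mem bxy) // !inE eqxx orbT.
exists (a * c' - c * a'); last by move=> phi alt; rewrite Ex Ey alt_form_comb.
(* If the determinant vanished, [a' x - a y] and then [c' x - c y] would be zero; freeness kills all
   four coefficients, so [x = 0], a contradiction. *)
apply/eqP => det0; have /free2P fxy := basis_free bxy.
have [a'0 /oppr_inj/eqP] : a' = 0 /\ - a = - 0.
  rewrite oppr0; apply: fxy; rewrite Ex Ey !scalerDr !scalerA addrACA -!scalerDl.
  have -> : a' * a + - a * a' = 0 by ring.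
  have -> : a' * c + - a * c' = - (a * c' - c * a') by ring.
  by rewrite det0 oppr0 !scale0r addr0.
move=> /eqP a0.
have [c'0 /oppr_inj c0] : c' = 0 /\ - c = - 0.
  rewrite oppr0; apply: fxy; rewrite Ex Ey !scalerDr !scalerA addrACA -!scalerDl.
  have -> : c' * a + - c * a' = a * c' - c * a' by ring.
  have -> : c' * c + - c * c' = 0 by ring.
  by rewrite det0 !scale0r addr0.
have [/eqP] : (1 : F) = 0 /\ (0 : F) = 0.
  by apply: fxy; rewrite Ex a0 c0 !scale0r !addr0 scaler0.
by rewrite oner_eq0.
Qed.

Lemma alt_form_dependent phi (alt : forall x, phi x x = 0) x y :
  ~~ free [:: x; y] -> phi x y = 0.
Proof.
rewrite free_cons span_seq1 seq1_free negb_and !negbK.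
case/orP=> [/vlineP[a ->] | /eqP->]; last by rewrite linear0.
by rewrite bilinZl alt mulr0.
Qed.

End Forms.

(** * The quadric and its polar form in characteristic 2 *)

Section Quadric.

Variables (F : finFieldType) (n h : nat).
Hypothesis card_F : #|F| = (2 ^ h)%N.

Local Notation V := 'rV[F]_(2 * n).+1.
Local Notation e i := (delta_mx (0 : 'I_1) (inord i : 'I_(2 * n).+1) : V).
Local Notation eN := (delta_mx (0 : 'I_1) (ord_max : 'I_(2 * n).+1) : V).
Implicit Types x y z : V.

Lemma pchar2 : 2%N \in [pchar F].
Proof. exact: card_finPcharP card_F isT. Qed.

Lemma sqrD (a c : F) : (a + c) ^+ 2 = a ^+ 2 + c ^+ 2.
Proof.
have := pFrobenius_autD_comm pchar2 (mulrC a c).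
by rewrite !pFrobenius_autE.
Qed.

(** In characteristic 2 squaring is additive with trivial kernel, hence injective, hence onto the
    finite field. *)
Lemma sqrt_exists (a : F) : exists r, r ^+ 2 = a.
Proof.
have inj : injective (fun r : F => r ^+ 2).
  move=> r s /= E; apply/eqP; rewrite -subr_eq0 (GRing.subr_pchar2 pchar2).
  by rewrite -sqrf_eq0 sqrD E addrr_pchar2 // pchar2.
by have [g _ gK] := injF_bij inj; exists (g a).
Qed.

(** The square of the last coordinate is additive in characteristic 2, so polarisation removes it
    and only the hyperbolic pairs remain. *)
Lemma betaE x y :
  beta x y = \sum_(i < n) (x 0 (inord (2 * i)) * y 0 (inord (2 * i).+1)
                         + y 0 (inord (2 * i)) * x 0 (inord (2 * i).+1)).
Proof.
rewrite /beta /eta.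
under eq_bigr do rewrite !mxE mulrDl !mulrDr.
rewrite !big_split /= !mxE sqrD; ring.
Qed.

Lemma betaC x y : beta x y = beta y x.
Proof. by rewrite !betaE; apply: eq_bigr => i _; ring. Qed.

Lemma betaDr x y z : beta x (y + z) = beta x y + beta x z.
Proof.
by rewrite !betaE -big_split /=; apply: eq_bigr => i _; rewrite !mxE; ring.
Qed.

Lemma betaZZ a c x y : beta (a *: x) (c *: y) = a * c * beta x y.
Proof.
by rewrite !betaE mulr_sumr; apply: eq_bigr => i _; rewrite !mxE; ring.
Qed.

Lemma etaZ a x : eta (a *: x) = a ^+ 2 * eta x.
Proof.
rewrite /eta mulrDr mulr_sumr !mxE exprMn; congr (_ + _).
by apply: eq_bigr => i _; rewrite !mxE; ring.
Qed.

Lemma etaD x y : eta (x + y) = eta x + eta y + beta x y.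
Proof. by rewrite /beta; ring. Qed.

Lemma eta0 : eta (0 : V) = 0.
Proof. by rewrite -(scale0r (0 : V)) etaZ expr0n mul0r. Qed.

Lemma sing_lineP (l : {vspace V}) :
  reflect (\dim l = 2 /\ forall x, x \in l -> eta x = 0) (is_sing_line l).
Proof.
apply: (iffP andP) => -[/eqP diml H]; split => //.
  by move=> x xl; apply/eqP/(implyP (forallP H x)).
by apply/forallP => x; apply/implyP => /H/eqP.
Qed.

Lemma span_sing_line x y : free [:: x; y] -> eta x = 0 -> eta y = 0 ->
  beta x y = 0 -> is_sing_line <<[:: x; y]>>%VS.
Proof.
move=> fxy x0 y0 xy0; apply/sing_lineP; split; first exact/eqP.
by move=> _ /mem_span2P[a [c ->]]; rewrite etaD !etaZ betaZZ x0 y0 xy0; ring.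
Qed.

Lemma eval_e (i j : nat) : (i <= 2 * n)%N -> (j <= 2 * n)%N ->
  e i 0 (inord j) = (i == j)%:R.
Proof. by move=> li lj; rewrite mxE eqxx -val_eqE /= !inordK // eq_sym. Qed.

Lemma eN_e : eN = e (2 * n).
Proof. by congr delta_mx; apply: val_inj; rewrite /= inordK. Qed.

Lemma beta_eN x : beta x eN = 0.
Proof.
rewrite betaE big1 // => i _; have lti := ltn_ord i.
rewrite eN_e !eval_e; try lia.
by rewrite !gtn_eqF /= ?mul0r ?mulr0 ?addr0 //; lia.
Qed.

Lemma eta_eN : eta eN = 1.
Proof. by rewrite -[eN]add0r -[eN]scale1r (eta_addN card_F) eta0 expr1n add0r. Qed.

Lemma eta_e j : (j < 2 * n)%N -> eta (e j) = 0.
Proof.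
move=> ltj; rewrite /eta mxE eqxx -val_eqE /= inordK; last lia.
rewrite gtn_eqF // expr0n addr0 big1 // => i _; have lti := ltn_ord i.
rewrite !eval_e; try lia.
by case: eqP => [->|_]; rewrite /= ?mul0r // ltn_eqF ?mulr0.
Qed.

(** Here [j./2] is the number of the hyperbolic pair containing [e j]. *)
Lemma beta_e_distinct j m : (j < 2 * n)%N -> (m < 2 * n)%N -> j./2 != m./2 ->
  beta (e j) (e m) = 0.
Proof.
move=> ltj ltm neq; rewrite betaE big1 // => i _; have lti := ltn_ord i.
rewrite !eval_e; try lia.
rewrite -!natrM -natrD !mulnb.
have -> : (j == 2 * i)%N && (m == (2 * i).+1) = false by lia.
by have -> : (m == 2 * i)%N && (j == (2 * i).+1)%N = false by lia.
Qed.

Lemma beta_e_pair k : (k < n)%N -> beta (e (2 * k)) (e (2 * k).+1) = 1.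
Proof.
move=> ltk; rewrite betaE (bigD1 (Ordinal ltk)) //= !eval_e; try lia.
rewrite !eqxx gtn_eqF ?leqnn // mul1r mul0r addr0 big1 ?addr0 // => i.
rewrite -val_eqE /= => neq; have lti := ltn_ord i.
rewrite !eval_e; try lia.
rewrite -!natrM -natrD !mulnb.
have -> : (2 * k == 2 * i)%N = false by lia.
by have -> : ((2 * k).+1 == 2 * i)%N = false by lia.
Qed.

(** * Forms vanishing on all totally singular lines *)

Section Vanishing.

Variables (b : sing_line F n -> V * V) (phi : bilin_form V).
Hypotheses (b_bases : line_bases (fun l : sing_line F n => sval l) b)
  (alt : forall x, phi x x = 0)
  (phi_b : forall l, phi (b l).1 (b l).2 = 0).

(** Independent [x], [y] span a totally singular line, and replacing its chosen basis changes the
    value of [phi] only by a scalar; for dependent vectors alternation suffices. *)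
Lemma vanish_orthogonal x y : eta x = 0 -> eta y = 0 -> beta x y = 0 ->
  phi x y = 0.
Proof.
move=> x0 y0 xy0; have [fxy|] := boolP (free [:: x; y]); last first.
  exact: alt_form_dependent.
pose l : sing_line F n := Sub _ (span_sing_line fxy x0 y0 xy0).
have bxy : basis_of (sval l) [:: x; y] by rewrite /basis_of eqxx.
have [d _ ->//] := alt_form_basis_change (b_bases l) bxy.
by rewrite phi_b mulr0.
Qed.

Lemma vanish_hyperbolic x p q : eta x = 0 -> eta p = 0 -> eta q = 0 ->
  beta x p = 0 -> beta x q = 0 -> beta p q = 1 -> phi eN x = 0.
Proof.
move=> x0 p0 q0 xp xq pq.
have : phi x (p + q + eN) = 0.
  apply: vanish_orthogonal => //; last by rewrite !betaDr xp xq beta_eN !addr0.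
  (* The value [eta (p + q + eN)] reduces to [beta p q + eta eN = 1 + 1], which is zero. *)
  rewrite !etaD p0 q0 pq beta_eN eta_eN -[RHS](addrr_pchar2 pchar2 1); ring.
rewrite !linearD /= (vanish_orthogonal x0 p0 xp) (vanish_orthogonal x0 q0 xq) !add0r => xN.
by rewrite (alt_form_anti alt) xN oppr0.
Qed.

Lemma vanish_nucleus : (2 <= n)%N -> phi eN = 0.
Proof.
move=> n_ge2; apply/lfunP => x; rewrite lfunE /=.
rewrite (row_sum_delta x) linear_sum big1 // => j _.
rewrite linearZ /=; have [ltj|] := ltnP j (2 * n); last first.
  move=> gej; have -> : j = ord_max by apply: val_inj => /=; have := ltn_ord j; lia.
  by rewrite alt scaler0.
(* A hyperbolic pair other than the one containing [e j]; pair 1 is available because [n >= 2]. *)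
pose k := if (j./2 == 0)%N then 1%N else 0%N.
have [ltk neqk] : (k < n)%N /\ k != j./2 by rewrite /k; case: eqP; lia.
rewrite -[j]inord_val.
rewrite (@vanish_hyperbolic _ (e (2 * k)) (e (2 * k).+1)) ?scaler0 ?eta_e ?beta_e_pair //;
  try lia; by rewrite beta_e_distinct //; lia.
Qed.

End Vanishing.

(** * Projection of totally singular lines from the nucleus *)

Section Projection.

Variables (W : vectType F) (pi : 'Hom(V, W)).
Hypothesis pi_quotient : quotient_map (nucleus F n) pi.

Lemma pi_eN : pi eN = 0.
Proof.
case: pi_quotient => _ kerpi; apply/eqP.
by rewrite -memv_ker kerpi memv_line.
Qed.

(** Adding [r *: eN] stays in the coset of the nucleus and changes [eta] by [r ^+ 2], so a square
    root of [eta x] yields a singular representative. *)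
Lemma singular_lift u : exists2 x, pi x = u & eta x = 0.
Proof.
case: pi_quotient => im_pi _.
have /memv_imgP[x _ ->] : u \in limg pi by rewrite im_pi memvf.
have [r rE] := sqrt_exists (eta x).
exists (x + r *: eN); first by rewrite linearD linearZ /= pi_eN scaler0 addr0.
by rewrite (eta_addN card_F) rE addrr_pchar2 // pchar2.
Qed.

(** Vectors of one coset differ by some [a *: eN], which changes [eta] by [a ^+ 2]; if both are
    singular, [a = 0]. *)
Lemma singular_lift_inj x y : eta x = 0 -> eta y = 0 -> pi x = pi y -> x = y.
Proof.
case: pi_quotient => _ kerpi x0 y0 pixy.
have /vlineP[a Ea] : x - y \in nucleus F n.
  by rewrite -kerpi memv_ker linearB /= pixy subrr.
have Ex : x = y + a *: eN by rewrite -Ea addrC subrK.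
move: x0; rewrite Ex (eta_addN card_F) y0 add0r => /eqP.
by rewrite sqrf_eq0 => /eqP ->; rewrite scale0r addr0.
Qed.

(** A kernel vector on the line and 0 are both singular lifts of 0. Hence [pi] is injective on the
    line and carries its bases to bases. *)
Lemma sing_line_capker (l : sing_line F n) : (val l :&: lker pi = 0)%VS.
Proof.
have [_ sing] := sing_lineP _ (valP l).
apply/eqP; rewrite -subv0; apply/subvP => x; rewrite memv_cap memv_ker memv0.
case/andP=> /sing x0 /eqP pix.
by apply/eqP/singular_lift_inj; rewrite ?eta0 ?linear0.
Qed.

Lemma line_proj_inj : injective (line_proj card_F pi_quotient).
Proof.
move=> l1 l2 /(congr1 val) /= pi12; apply: val_inj => /=.
have [[dim1 sing1] [dim2 sing2]] := (sing_lineP _ (valP l1), sing_lineP _ (valP l2)).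
apply/eqP; rewrite eqEdim dim1 dim2 andbT; apply/subvP => x xl1.
have /memv_imgP[y yl2 pixy] : pi x \in (pi @: val l2)%VS.
  by rewrite -pi12 memv_img.
by rewrite (singular_lift_inj (sing1 x xl1) (sing2 y yl2) pixy).
Qed.

(** Singular lifts of a basis are orthogonal, since [beta_sp] pulls back to [beta], so they span a
    totally singular line. *)
Lemma line_proj_surj (m : isot_line pi) u v : basis_of (val m) [:: u; v] ->
  exists l, line_proj card_F pi_quotient l = m.
Proof.
move=> buv; have [x pix x0] := singular_lift u; have [y piy y0] := singular_lift v.
have xy0 : beta x y = 0.
  rewrite -(beta_sp_pi card_F pi_quotient) pix piy.
  have /andP[_ /forallP/(_ u)/forallP/(_ v)] := valP m.
  by rewrite !(basis_mem buv) ?inE ?eqxx ?orbT //= => /eqP.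
have fxy : free [:: x; y].
  apply/free2P => a c E; have /free2P := basis_free buv; apply.
  by rewrite -pix -piy -!linearZ -linearD /= E linear0.
exists (Sub _ (span_sing_line fxy x0 y0 xy0)); apply: val_inj => /=.
by rewrite limg_span /= pix piy; apply/eqP; case/andP: buv.
Qed.

End Projection.

End Quadric.

(** * Alternating forms and codes modulo the span of a vector *)

Section QuotientCode.

Variables (F : finFieldType) (V W : vectType F) (pi : 'Hom(V, W)) (v : V).
Hypotheses (v_neq0 : v != 0) (pi_quotient : quotient_map <[v]>%VS pi).
Variables (I : finType) (b : I -> V * V).

Local Notation pib := (fun i => (pi (b i).1, pi (b i).2)).

Lemma alt_form_pullback (psi : bilin_form W) : (forall u, psi u u = 0) ->
  exists2 phi : bilin_form V, forall x, phi x x = 0 &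
    forall x y, phi x y = psi (pi x) (pi y).
Proof.
move=> alt.
have [||phi phiE] := @bilin_form_exists F V (fun x y => psi (pi x) (pi y)).
- by move=> x a y z; rewrite !linearP.
- by move=> y a x z; rewrite !linearP add_lfunE scale_lfunE.
by exists phi => // x; rewrite phiE.
Qed.

(** The form is evaluated on representatives chosen by [pi^-1]. The choice is harmless because [v]
    lies in the radical, on the left by hypothesis and on the right by antisymmetry. *)
Lemma alt_form_descend (phi : bilin_form V) :
    (forall x, phi x x = 0) -> phi v = 0 ->
  exists2 psi : bilin_form W, forall u, psi u u = 0 &
    forall x y, phi x y = psi (pi x) (pi y).
Proof.
move=> alt phiv.
have [||psi psiE] :=
    @bilin_form_exists F W (fun u w => phi ((pi^-1)%VF u) ((pi^-1)%VF w)).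
- by move=> x a y z; rewrite !linearP.
- by move=> y a x z; rewrite !linearP add_lfunE scale_lfunE.
have lift x : exists a : F, (pi^-1)%VF (pi x) = x + a *: v.
  have /vlineP[a Ea] : (pi^-1)%VF (pi x) - x \in <[v]>%VS.
    case: pi_quotient => _ <-.
    by rewrite memv_ker linearB /= limg_lfunVK ?memv_img ?memvf // subrr.
  by exists a; rewrite -Ea addrC subrK.
exists psi => [u|x y]; rewrite psiE //.
have [[a ->] [c ->]] := (lift x, lift y).
rewrite bilinDl bilinZl phiv lfunE mulr0 addr0 linearD linearZ /=.
by rewrite (alt_form_anti alt x v) phiv lfunE oppr0 scaler0 addr0.
Qed.

Lemma quotient_code_sub : (line_code pib <= line_code b)%VS.
Proof.
apply/subvP => _ /line_codeP[psi alt ->].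
have [phi phi_alt phiE] := alt_form_pullback alt.
by apply/line_codeP; exists phi => //; apply/ffunP => i; rewrite !ffunE phiE.
Qed.

(** The kernel of [eval] is the annihilator of [v] in the dual space; an alternating form has [v] in
    its radical exactly when [contract] kills it. *)
Let eval (f : 'Hom(V, F^o)) : F^o := f v.
Let contract (phi : bilin_form V) : 'Hom(V, F^o) := phi v.

Fact eval_linear : linear eval.
Proof. by move=> a f g; rewrite /eval add_lfunE scale_lfunE. Qed.

Fact contract_linear : linear contract.
Proof. by move=> a f g; rewrite /contract add_lfunE scale_lfunE. Qed.

HB.instance Definition _ := GRing.isLinear.Build _ _ _ _ eval eval_linear.
HB.instance Definition _ :=
  GRing.isLinear.Build _ _ _ _ contract contract_linear.

Lemma dual_vector : exists c : 'Hom(V, F^o), c v = 1.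
Proof.
exists (linfun (coord [tuple v] ord0 : V -> F^o)); rewrite lfunE /=.
have := @coord_free _ _ _ [tuple v] ord0 ord0.
by rewrite /= seq1_free => ->.
Qed.

Lemma dim_annihilator : (\dim (lker (linfun eval))).+1 = dim V.
Proof.
have [c cv] := dual_vector.
have := limg_ker_dim (linfun eval) fullv; rewrite capfv.
have -> : limg (linfun eval) = fullv.
  apply/vspaceP => a; rewrite memvf; apply/memv_imgP; exists (a *: c); rewrite ?memvf //.
  by rewrite lfunE /= /eval scale_lfunE cv; exact/esym/mulr1.
by rewrite !dimvf addn1 => ->; exact: muln1.
Qed.

(** Alternation gives one inclusion. Conversely, if [f v = 0] and [c v = 1], then [f] is the
    contraction of the wedge of [c] and [f]. *)
Lemma contract_alt_forms :
  (linfun contract @: alt_forms V = lker (linfun eval))%VS.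
Proof.
apply/vspaceP => f; rewrite memv_ker lfunE /=.
apply/memv_imgP/eqP => [[phi /alt_formsP alt ->]|fv].
  by rewrite lfunE; exact: alt.
have [c cv] := dual_vector.
(* Linearity of [c x * f y - f x * c y] in [y], then in [x], as identities between scalars. *)
have expandr (a p q r s t u : F) :
    p * (a * q + r) - s * (a * t + u) = a * (p * q - s * t) + (p * r - s * u).
  by ring.
have expandl (a p q r s t u : F) :
    (a * q + r) * p - (a * t + u) * s = a * (q * p - t * s) + (r * p - u * s).
  by ring.
have [||phi phiE] := @bilin_form_exists F V (fun x y => c x * f y - f x * c y).
- move=> x a y z; rewrite (linearP c) (linearP f).
  exact: (expandr a (c x) (f y) (f z) (f x) (c y) (c z)).
- move=> y a x z; rewrite (linearP c) (linearP f).
  exact: (expandl a (f y) (c x) (c z) (c y) (f x) (f z)).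
exists phi; first by apply/alt_formsP => x; rewrite phiE mulrC subrr.
apply/lfunP => x; rewrite lfunE /= /contract phiE cv.
by rewrite -[f v]/(eval f) fv mul0r subr0 mul1r.
Qed.

(** Pulling back along [pi] yields exactly the alternating forms with [v] in their radical, and
    preserves the words. *)
Lemma quotient_codeE : line_code pib =
  (linfun (codeword b) @: (alt_forms V :&: lker (linfun contract)))%VS.
Proof.
apply/vspaceP => w; apply/line_codeP/memv_imgP => [[psi alt ->]|[phi]].
  have [phi phi_alt phiE] := alt_form_pullback alt.
  exists phi; last by rewrite lfunE; apply/ffunP => i; rewrite !ffunE phiE.
  rewrite memv_cap memv_ker lfunE /=; apply/andP; split; first exact/alt_formsP.
  apply/eqP/lfunP => x; rewrite /contract phiE lfunE.
  have -> : pi v = 0; last by rewrite linear0 lfunE.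
  by apply/eqP; rewrite -memv_ker; case: pi_quotient => _ ->; exact: memv_line.
rewrite memv_cap memv_ker lfunE /= => /andP[/alt_formsP alt /eqP phiv] ->.
have [psi psi_alt phiE] := alt_form_descend alt phiv.
by exists psi => //; rewrite lfunE; apply/ffunP => i; rewrite !ffunE phiE.
Qed.

(** Rank-nullity is applied to [cw] and [ct] on [A], and to [cw] on the part of [A] killed by [ct];
    by the vanishing hypothesis [cw] has the same kernel on both. The codimension [dim V - 1] is
    stated without subtraction. *)
Lemma dim_quotient_code :
    (forall phi : bilin_form V, (forall x, phi x x = 0) ->
       (forall i, phi (b i).1 (b i).2 = 0) -> phi v = 0) ->
  (\dim (line_code b)).+1 = (\dim (line_code pib) + dim V)%N.
Proof.
move=> vanish; rewrite quotient_codeE /line_code -dim_annihilator.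
rewrite -contract_alt_forms addnS; congr _.+1.
set A := alt_forms V; set cw := linfun (codeword b); set ct := linfun contract.
have dims (k x y z s t : nat) :
  (k + x = s -> k + y = t -> s + z = t -> y = x + z)%N by lia.
suff kerE : (A :&: lker ct :&: lker cw = A :&: lker cw)%VS.
  apply: (dims _ _ _ _ _ _ _ (limg_ker_dim cw A) (limg_ker_dim ct A)).
  by rewrite -kerE limg_ker_dim.
rewrite -capvA [(lker ct :&: _)%VS]capvC capvA; apply/capv_idPl.
apply/subvP => phi; rewrite memv_cap => /andP[/alt_formsP alt].
rewrite !memv_ker !lfunE /= => /eqP/ffunP cw0; apply/eqP/vanish => // i.
by have := cw0 i; rewrite !ffunE.
Qed.

End QuotientCode.

Theorem mainTheorem3 (F : finFieldType) (h n : nat)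
    (card_F : #|F| = (2 ^ h)%N) (n_ge2 : (2 <= n)%N)
    (W : vectType F) (pi : 'Hom('rV[F]_(2 * n).+1, W))
    (pi_quotient : quotient_map (nucleus F n) pi)
    (b : sing_line F n -> 'rV[F]_(2 * n).+1 * 'rV[F]_(2 * n).+1)
    (b_bases : line_bases (fun l : sing_line F n => sval l) b)
    (b_sp : isot_line pi -> W * W)
    (b_sp_bases : line_bases (fun l : isot_line pi => sval l) b_sp) :
  exists D : {vspace {ffun sing_line F n -> F^o}},
    [/\ monomially_equivalent_along (line_proj card_F pi_quotient)
          (line_code b_sp) D,
        (D <= line_code b)%VS,
        D <> line_code b
      & \dim (line_code b) = (\dim D + 2 * n)%N].
Proof.
have vanish (phi : bilin_form 'rV[F]_(2 * n).+1) : (forall x, phi x x = 0) ->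
    (forall l, phi (b l).1 (b l).2 = 0) -> phi (delta_mx 0 ord_max) = 0.
  by move=> alt phi_b; apply: (vanish_nucleus card_F b_bases alt phi_b n_ge2).
have eN_neq0 : (delta_mx 0 ord_max : 'rV[F]_(2 * n).+1) != 0.
  apply/eqP => /matrixP/(_ 0 ord_max)/eqP.
  by rewrite !mxE !eqxx oner_eq0.
have dimC := dim_quotient_code eN_neq0 pi_quotient vanish.
have {}dimC : \dim (line_code b)
    = (\dim (line_code (fun l => (pi (b l).1, pi (b l).2))) + 2 * n)%N.
  (* The row space has dimension [1 * (2 * n).+1], whence [mul1n]. *)
  by apply: succn_inj; rewrite dimC -addnS; congr (_ + _)%N; exact: mul1n.
(* The witness is the code of the projected bases, already indexed by the totally singular lines. *)
exists (line_code (fun l => (pi (b l).1, pi (b l).2))); split=> //.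
- split.
    have surj m : exists l, line_proj card_F pi_quotient l = m.
      exact: line_proj_surj (b_sp_bases m).
    have [g gK] := fin_all_exists surj.
    by exists g => // l; apply: (@line_proj_inj _ _ _ card_F _ _ pi_quotient); rewrite gK.
  (* The projected basis and the one chosen by [b_sp] span the same line; the determinant between
     them is the coordinate scalar, the same for every form. *)
  have scalar l : exists d : F, d != 0 /\
      forall psi : bilin_form W, (forall u, psi u u = 0) ->
        psi (pi (b l).1) (pi (b l).2) =
        d * psi (b_sp (line_proj card_F pi_quotient l)).1
                (b_sp (line_proj card_F pi_quotient l)).2.
    have bl : basis_of (sval (line_proj card_F pi_quotient l))
                [:: pi (b l).1; pi (b l).2].
      rewrite /= -[[:: _; _]]/(map pi [:: (b l).1; (b l).2]).
      by apply: limg_basis_of (b_bases l); apply: (sing_line_capker card_F).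
    have [d d0 dE] := alt_form_basis_change (b_sp_bases _) bl.
    by exists d.
  have [d dE] := fin_all_exists scalar.
  exists d => [l|w]; first by case: (dE l).
  split=> [/line_codeP[psi alt ->]|[_ /line_codeP[psi alt ->] ->]].
    exists [ffun m => psi (b_sp m).1 (b_sp m).2].
      by apply/line_codeP; exists psi.
    by apply/ffunP => l; rewrite !ffunE (dE l).2.
  apply/line_codeP; exists psi => //.
  by apply/ffunP => l; rewrite !ffunE (dE l).2.
- exact: quotient_code_sub.
(* Equality would force [2 * n = 0]. *)
- by move=> DC; move: dimC; rewrite DC; lia.
Qed.
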